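(* Fix real numbers $c>0$ and $0<\alpha<1/2$. For each (large enough) $n$, let $\ell$ be the length of the longest non-decreasing subsequence of a uniformly random word of length $n$ whose letters are integers between $1$ and $c\cdot\lfloor n^{\alpha}\rfloor$. Then for every $\varepsilon>0$, when $n$ tends to infinity, one has in probability $\ell=o(n^{1-\alpha+\varepsilon})$, i.e. $\ell/n^{1-\alpha+\varepsilon}\to0$ in probability.
   Context: A non-decreasing subsequence of a word $w_1\cdots w_n$ is a sequence of positions $i_1<\cdots<i_k$ with $w_{i_1}\leq\cdots\leq w_{i_k}$; its length is $k$. The word is uniform among all words of length $n$ over the alphabet of integers $j$ with $1\leq j\leq c\lfloor n^\alpha\rfloor$ (non-empty for $n$ large). *)

(* Defs.v *)
From mathcomp Require Import all_boot all_order all_algebra.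
From mathcomp Require Import all_classical all_reals all_analysis.

Set Implicit Arguments.
Unset Strict Implicit.
Unset Printing Implicit Defensive.

Import Order.TTheory GRing.Theory Num.Theory.
Import numFieldNormedType.Exports.

Local Open Scope ring_scope.

Section UniformProbability.
Variable R : realType.

(* When [A] is empty this is the junk value 0. *)
Definition uniform_pr (T : finType) (A : {set T}) (E : pred T) : R :=
  #|[pred w in A | E w]|%:R / #|A|%:R.

(* The [n]-th random variable lives on its own probability space, namely
   [A n] with the uniform distribution. *)
Definition cvg_in_uniform_pr (T : nat -> finType) (A : forall n, {set T n})
    (X : forall n, T n -> R) (l : R) : Prop :=
  forall delta : R, 0 < delta ->
    (uniform_pr (A n) (fun w => delta < `|X n w - l|) @[n --> \oo]
      --> (0 : R))%classic.

End UniformProbability.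

Section Words.
Variables n m : nat.

(* The positions i_1 < ... < i_k form the tuple [p]. *)
Definition is_nondecreasing_subseq (w : n.-tuple 'I_m) (k : nat)
    (p : k.-tuple 'I_n) : bool :=
  sorted (fun i j : 'I_n => (i < j)%N) p &&
  sorted (fun a b : 'I_m => (a <= b)%N) [seq tnth w i | i <- p].

(* Positions are distinct, so lengths range over 0, ..., n. *)
Definition longest_nondecreasing (w : n.-tuple 'I_m) : nat :=
  \max_(k < n.+1 | [exists p : k.-tuple 'I_n, is_nondecreasing_subseq w p]) k.

End Words.

Section Alphabet.
Variables (R : realType) (c alpha : R).

Definition letter_bound (n : nat) : R :=
  c * (Num.floor (n%:R `^ alpha))%:~R.

(* The finite type of naturals j <= trunc (letter_bound n) contains every
   natural j with j <= letter_bound n. *)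
Definition letter (n : nat) : finType := 'I_(Num.truncn (letter_bound n)).+1.

Definition words (n : nat) : {set n.-tuple (letter n)} :=
  [set w : n.-tuple (letter n) |
    [forall i : 'I_n, (1 <= tnth w i)%N &&
                      ((tnth w i : nat)%:R <= letter_bound n)]].

End Alphabet.

(* Main.v *)
Require Import Defs.
From mathcomp Require Import all_boot all_order all_algebra.
From mathcomp Require Import ring lra.
From mathcomp Require Import all_classical all_reals all_analysis.
Import Order.TTheory GRing.Theory Num.Theory.
Import numFieldNormedType.Exports.

(** The proof is a first moment bound.  Let [k] be the number of letters and
    let [L] be the least integer above [d * n `^ (1 - alpha + eps)], where [d]
    is the threshold in the convergence in probability.  A word whose longest
    non-decreasing subsequence has length at least [L] contains one of length
    exactly [L]; choosing its [L] positions, its [L] non-decreasing letters and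
    then the remaining [n - L] letters freely shows that at most
    ['C(n, L) * 'C(L + k, L) * k ^ (n - L)] of the [k ^ n] words are of that
    kind ([leq_card_longest]).

    The first binomial is at most [(4 n / L) ^ L] ([leq_bin_expn]).  Since
    [k] is at most [c * n `^ alpha] and [alpha < 1 - alpha], eventually
    [k <= L], so the second one is at most [4 ^ L].  Hence the probability is
    at most [(16 n / (L k)) ^ L] ([uniform_pr_longest_le]).  As [k] is also of
    order at least [c * n `^ alpha], the product [L * k] is at least of order
    [n `^ (1 + eps)], so the base of this power is [O(n `^ (- eps))].  It is
    eventually less than [1], and then the power is at most its base, which
    tends to [0]. *)

Set Implicit Arguments.
Unset Strict Implicit.
Unset Printing Implicit Defensive.

(** * Bounds on binomial coefficients *)

Lemma leq_bin_exp2 n m : 'C(n, m) <= 2 ^ n.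
Proof.
elim: n m => [|n IHn] [|m]; rewrite ?bin0 ?bin0n // ?expn_gt0 //.
by rewrite binS expnS mul2n -addnn leq_add.
Qed.

(** A substitute for Stirling's formula: each of the [L] factors of the falling
    factorial [(2 * L) ^_ L = 'C(2 * L, L) * L`!] is at least [L]. *)
Lemma leq_expn_fact L : L ^ L <= 4 ^ L * L`!.
Proof.
apply: (@leq_trans ((2 * L) ^_ L)).
  rewrite ffact_prod -[X in _ ^ X](card_ord L) -prod_nat_const leq_prod // => i _.
  by rewrite mul2n -addnn -addnBA ?leq_addr // ltnW.
have -> : 4 ^ L = 2 ^ (2 * L) by rewrite expnM.
by rewrite -bin_ffact leq_mul2r leq_bin_exp2 orbT.
Qed.

Lemma leq_bin_expn n L : 'C(n, L) * L ^ L <= (4 * n) ^ L.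
Proof.
apply: (@leq_trans ('C(n, L) * (4 ^ L * L`!))).
  by rewrite leq_mul2l leq_expn_fact orbT.
rewrite mulnCA bin_ffact expnMn leq_mul2l; apply/orP; right.
rewrite ffact_prod -[X in _ ^ X](card_ord L) -prod_nat_const leq_prod // => i _.
exact: leq_subr.
Qed.

(** * Counting words with a long non-decreasing subsequence *)

Lemma leq_card_bigcup (I T : finType) (P : {set I}) (A : I -> {set T}) :
  #|\bigcup_(i in P) A i| <= \sum_(i in P) #|A i|.
Proof.
elim/big_rec2: _ => [|i m B _ IH]; first by rewrite cards0.
by apply: (leq_trans (leq_card_setU _ _)); rewrite leq_add2l.
Qed.

(** Tuples are identified with finite functions, whose families are counted by
    [card_family]. *)
Lemma card_tuple_family (T : finType) n (F : 'I_n -> pred T) :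
  #|[set w : n.-tuple T | [forall i, F i (tnth w i)]]| = \prod_i #|F i|.
Proof.
have -> : \prod_i #|F i| = #|family F| by rewrite card_family foldrE big_image.
rewrite -(cardsE (family F)) -(@on_card_preimset _ _ (@finfun_of_tuple T n)).
  apply: eq_card => w; rewrite !inE; apply: eq_forallb => i.
  by rewrite /finfun_of_tuple ffunE.
apply: onW_bij; exists (@tuple_of_finfun T n).
  exact: finfun_of_tupleK.
exact: tuple_of_finfunK.
Qed.

Lemma card_tuple_over (T : finType) n (S : {set T}) :
  #|[set w : n.-tuple T | [forall i, tnth w i \in S]]| = #|S| ^ n.
Proof.
by rewrite (card_tuple_family (fun _ : 'I_n => [in S])) prod_nat_const card_ord.
Qed.

(** Prescribing the letters of a word at [L] distinct positions leaves only
    [n - L] free choices.  The letters in [t] may lie outside [S], which is why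
    this is not an equality. *)
Lemma leq_card_tuple_prescribed (T : finType) n L (S : {set T})
    (p : L.-tuple 'I_n) (t : L.-tuple T) : uniq p ->
  #|[set w : n.-tuple T | [forall i, tnth w i \in S] &
                          [seq tnth w i | i <- p] == t :> seq T]|
    <= #|S| ^ (n - L).
Proof.
move=> up.
(* The default letter [x] of [nth] is never returned: a position in [p] has an
   index smaller than the size of [t]. *)
pose F i : pred T :=
  fun x => if i \in p then x == nth x t (index i p) else x \in S.
apply: (@leq_trans #|[set w : n.-tuple T | [forall i, F i (tnth w i)]]|).
  apply/subset_leq_card/fintype.subsetP => w.
  rewrite !inE => /andP[/forallP wS /eqP wt].
  apply/forallP => i; rewrite /F; case: ifP => // pi.
  by rewrite -wt (nth_map i) ?index_mem // nth_index.
rewrite card_tuple_family.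
apply: (@leq_trans (\prod_i (if i \notin p then #|S| else 1))).
  apply: leq_prod => i _; case: ifP => [/negbTE ip | /negbT].
    apply/subset_leq_card/fintype.subsetP => x.
    by rewrite [x \in _]unfold_in /F ip.
  rewrite negbK => ip; apply/card_le1_eqP => x y.
  rewrite [x \in _]unfold_in [y \in _]unfold_in /F ip => /eqP-> /eqP->.
  apply: set_nth_default; rewrite size_tuple.
  by have := index_mem i p; rewrite size_tuple => ->.
rewrite -big_mkcond /= (prod_nat_const [predC p]).
have := cardC [in p]; rewrite (card_uniqP up) size_tuple card_ord => nE.
by rewrite -[X in _ ^ (X - L)]nE addKn.
Qed.

(** Any prefix of a non-decreasing subsequence is one, so a long subsequence
    yields one of each smaller length; the union bound can then be taken over
    a single length. *)
Lemma leq_longest_subseq n m (w : n.-tuple 'I_m) L :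
  L <= longest_nondecreasing w ->
  exists p : L.-tuple 'I_n, is_nondecreasing_subseq w p.
Proof.
have [k /existsP[p] /andP[ps ws] ->] :
    exists2 k : 'I_n.+1,
      [exists p : k.-tuple 'I_n, is_nondecreasing_subseq w p] & longest_nondecreasing w = k.
  have [|k hk eqk] := @eq_bigmax_cond _ [pred k : 'I_n.+1 |
      [exists p : k.-tuple 'I_n, is_nondecreasing_subseq w p]] (fun k => k).
    (* The empty subsequence shows that the maximum is attained. *)
    apply/card_gt0P; exists ord0; rewrite inE.
    by apply/existsP; exists [tuple].
  by exists k => //; rewrite -eqk; apply: eq_bigl.
move=> Lk.
have sz : size (take L p) == L by rewrite size_takel // size_tuple.
exists (Tuple sz); apply/andP; split => /=.
  by apply: subseq_sorted (take_subseq _ _) ps => y x z; apply: ltn_trans.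
rewrite map_take.
by apply: subseq_sorted (take_subseq _ _) ws => y x z; apply: leq_trans.
Qed.

(** The union bound over the positions [p] of the subsequence and over the
    letters [t] read there.  All of ['I_m.+1] is allowed for [t], even when [S]
    is smaller: this keeps the number of sorted [t] a binomial coefficient. *)
Lemma leq_card_longest n m L (S : {set 'I_m.+1}) :
  #|[set w : n.-tuple 'I_m.+1 | [forall i, tnth w i \in S] &
       L <= longest_nondecreasing w]|
    <= 'C(n, L) * 'C(L + m, L) * #|S| ^ (n - L).
Proof.
pose P := [set p : L.-tuple 'I_n | sorted ltn (map val p)].
pose Q := [set t : L.-tuple 'I_m.+1 | sorted leq (map val t)].
pose A (pt : L.-tuple 'I_n * L.-tuple 'I_m.+1) :=
  [set w : n.-tuple 'I_m.+1 | [forall i, tnth w i \in S] &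
     [seq tnth w i | i <- pt.1] == pt.2 :> seq 'I_m.+1].
apply: (@leq_trans #|\bigcup_(pt in finset.setX P Q) A pt|).
  apply/subset_leq_card/fintype.subsetP => w; rewrite !inE => /andP[wS].
  move=> /leq_longest_subseq[p /andP[ps ws]].
  apply/bigcupP; exists (p, map_tuple (tnth w) p); last by rewrite !inE wS /=.
  rewrite finset.in_setX !inE /= !sorted_map.
  by apply/andP; split; [exact: ps | rewrite -sorted_map; exact: ws].
apply: (leq_trans (leq_card_bigcup _ _)).
rewrite -(card_ltn_sorted_tuples L n) -(card_sorted_tuples L m) -cardsX.
rewrite -sum_nat_const; apply: leq_sum => -[p t]; rewrite !inE => /andP[/= pP _].
apply: (@leq_card_tuple_prescribed _ n L S p t).
rewrite -(map_inj_uniq val_inj).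
exact: (sorted_uniq ltn_trans ltnn).
Qed.

(** For [m <= L], the choice of the non-decreasing letters contributes a factor
    ['C(L + m, L) <= 2 ^ (2 * L)], which is merely exponential in [L]. *)
Lemma leq_card_longest_expn n m L (S : {set 'I_m.+1}) : m <= L ->
  #|[set w : n.-tuple 'I_m.+1 | [forall i, tnth w i \in S] &
       L <= longest_nondecreasing w]| * (L * #|S|) ^ L
    <= (16 * n) ^ L * #|S| ^ n.
Proof.
move=> mL; have card_le := @leq_card_longest n m L S.
(* [n - L] is truncated, so the case where no subsequence is that long is
   treated apart. *)
have [nL|Ln] := ltnP n L.
  by move: card_le; rewrite bin_small // leqn0 => /eqP->.
apply: leq_trans (_ : 'C(n, L) * 'C(L + m, L) * #|S| ^ (n - L) *
                      (L * #|S|) ^ L <= _).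
  by rewrite leq_mul2r card_le orbT.
have -> : 'C(n, L) * 'C(L + m, L) * #|S| ^ (n - L) * (L * #|S|) ^ L =
    ('C(n, L) * L ^ L) * 'C(L + m, L) * #|S| ^ n.
  rewrite -[X in _ = _ * _ ^ X](subnK Ln) expnD expnMn -!mulnA; congr (_ * _).
  by rewrite [in LHS](mulnCA (#|S| ^ (n - L))) [LHS]mulnCA.
rewrite leq_mul2r; apply/orP; right.
have -> : (16 * n) ^ L = (4 * n) ^ L * 2 ^ (L + L).
  by rewrite addnn -mul2n expnM -expnMn mulnAC.
apply: leq_mul (leq_bin_expn _ _) _.
by apply: leq_trans (leq_bin_exp2 _ _) _; rewrite leq_exp2l // leq_add2l.
Qed.

Local Open Scope ring_scope.

Lemma uniform_pr_longest_le (R : realType) (n m L : nat) (S : {set 'I_m.+1}) :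
    (0 < #|S|)%N -> (0 < L)%N -> (m <= L)%N ->
  uniform_pr R [set w : n.-tuple 'I_m.+1 | [forall i, tnth w i \in S]]
      (fun w => L <= longest_nondecreasing w)%N
    <= ((16 * n)%:R / (L * #|S|)%:R) ^+ L.
Proof.
move=> S0 L0 mL; rewrite /uniform_pr card_tuple_over expr_div_n.
rewrite ler_pdivrMr ?ltr0n ?expn_gt0 ?S0 // mulrAC.
rewrite ler_pdivlMr ?exprn_gt0 ?ltr0n ?muln_gt0 ?L0 //.
rewrite -!natrX -!natrM ler_nat.
apply: leq_trans (leq_card_longest_expn n S mL).
rewrite leq_mul2r; apply/orP; right; rewrite eq_leq //.
by apply: eq_card => w; rewrite !inE.
Qed.

(** * Asymptotics *)

Lemma cvgy_powR_natr (R : realType) (e : R) : 0 < e ->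
  ((n%:R : R) `^ e @[n --> \oo] --> +oo)%classic.
Proof.
move=> e0; apply/cvgryPge => A.
pose B := Num.max A 0 `^ e^-1.
have /cvgryPge/(_ B) := @cvgr_idn R.
apply: filterS => n Bn.
apply: (@le_trans _ _ (B `^ e)).
  rewrite -powRrM mulVf ?gt_eqF // powRr1 ?le_max ?lexx ?orbT //.
by apply: ge0_ler_powR => //; rewrite ?ltW // nnegrE ?powR_ge0 // ler0n.
Qed.

Section Alphabet.
Variables (R : realType) (c alpha : R) (n : nat).
Hypothesis c_gt0 : 0 < c.

Definition letters : {set letter c alpha n} :=
  [set x : letter c alpha n |
    (1 <= x)%N && ((x : nat)%:R <= letter_bound c alpha n)].

Lemma wordsE : words c alpha n = [set w | [forall i, tnth w i \in letters]].
Proof.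
by apply/setP => w; rewrite !inE; apply: eq_forallb => i; rewrite inE.
Qed.

Lemma letter_bound_ge0 : 0 <= letter_bound c alpha n.
Proof. by rewrite mulr_ge0 ?(ltW c_gt0) // ler0z floor_ge0 powR_ge0. Qed.

(** The only value of ['I_(Num.truncn _).+1] that is not a letter is [0]. *)
Lemma card_letters : #|letters| = Num.truncn (letter_bound c alpha n).
Proof.
have -> : letters = [set~ ord0].
  apply/setP => x; rewrite !inE -val_eqE -lt0n; case: (0 < x)%N => //=.
  by rewrite -truncn_ge_nat ?letter_bound_ge0 // -ltnS ltn_ord.
by rewrite cardsC1 card_ord.
Qed.

Lemma letter_bound_le : letter_bound c alpha n <= c * n%:R `^ alpha.
Proof. by rewrite ler_pM2l // floor_le. Qed.

Lemma card_letters_le : #|letters|%:R <= c * n%:R `^ alpha.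
Proof.
apply: le_trans letter_bound_le.
by rewrite card_letters truncn_le ?letter_bound_ge0.
Qed.

(** Each of the two roundings, of [n `^ alpha] and of [letter_bound], costs at
    most a factor [2] as soon as the rounded number is large enough. *)
Lemma card_letters_ge : 2 <= n%:R `^ alpha -> 4 / c <= n%:R `^ alpha ->
  c * n%:R `^ alpha / 4 <= #|letters|%:R.
Proof.
move=> h2 h4; rewrite card_letters.
have hb : c * (n%:R `^ alpha / 2) <= letter_bound c alpha n.
  rewrite ler_pM2l //; have := floorD1_gt (n%:R `^ alpha : R).
  by rewrite intrD; lra.
have := truncnS_gt (letter_bound c alpha n); rewrite -natr1.
by move: h4; rewrite ler_pdivrMr //; lra.
Qed.

End Alphabet.

Theorem corollary6 (R : realType) (c alpha : R)
    (c_gt0 : 0 < c) (alpha_gt0 : 0 < alpha) (alpha_lt : alpha < 1 / 2)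
    (eps : R) (eps_gt0 : 0 < eps) :
  cvg_in_uniform_pr (words c alpha)
    (fun n w => (longest_nondecreasing w)%:R / n%:R `^ (1 - alpha + eps)) 0.
Proof.
move=> d d_gt0.
have cd_gt0 : 0 < c * d by rewrite mulr_gt0.
(* The constant is [16 * 4]: [16] comes from [uniform_pr_longest_le] and [4] from
   [card_letters_ge]. *)
pose bound (n : nat) : R := 64 / (c * d) * (n%:R `^ eps)^-1.
have bound_cvg : (bound n @[n --> \oo] --> (0 : R))%classic.
  rewrite -[X in (_ --> X)%classic](mulr0 (64 / (c * d))).
  apply: cvgMl_tmp; apply/gtr0_cvgV0; last exact: cvgy_powR_natr.
  by near=> n; rewrite powR_gt0 // ltr0n; near: n; exact: nbhs_infty_gt.
have alpha_cvg := cvgy_powR_natr alpha_gt0.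
have eps_cvg := cvgy_powR_natr eps_gt0.
apply: (squeeze_cvgr _ (cvg_cst 0) bound_cvg).
near=> n.
have n_gt0 : (0 < n)%N by near: n; exact: nbhs_infty_gt.
have nR_gt0 : 0 < n%:R :> R by rewrite ltr0n.
have a_ge2 : 2 <= n%:R `^ alpha :> R.
  by near: n; move/cvgryPge: alpha_cvg; apply.
have a_ge4 : 4 / c <= n%:R `^ alpha :> R.
  by near: n; move/cvgryPge: alpha_cvg; apply.
have e_gec : c / d <= n%:R `^ eps :> R.
  by near: n; move/cvgryPge: eps_cvg; apply.
have e_ge64 : 64 / (c * d) <= n%:R `^ eps :> R.
  by near: n; move/cvgryPge: eps_cvg; apply.
apply/andP; split; first by rewrite /uniform_pr divr_ge0 // ler0n.
set a : R := n%:R `^ alpha in a_ge2 a_ge4 *.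
set e : R := n%:R `^ eps in e_gec e_ge64 *.
set b : R := n%:R `^ (1 - alpha + eps).
have e_gt0 : 0 < e by rewrite powR_gt0.
have a_gt0 : 0 < a by rewrite powR_gt0.
have b_gt0 : 0 < b by rewrite powR_gt0.
have abE : a * b = n%:R * e.
  rewrite /a /b /e -!powRD ?(gt_eqF nR_gt0) ?implybT //.
  rewrite -[X in _ = X * _](powRr1 (ltW nR_gt0)).
  rewrite -powRD ?(gt_eqF nR_gt0) ?implybT //.
  by congr (_ `^ _); lra.
(* The inequality [2 * alpha <= 1] enters here; it keeps the number of letters
   below [L]. *)
have ae_le_b : a * e <= b.
  rewrite /a /b /e -powRD ?(gt_eqF nR_gt0) ?implybT //.
  by apply: ler_powR; [rewrite ler1n | lra].
pose L := (Num.truncn (d * b)).+1.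
have dbL : d * b < L%:R by exact: truncnS_gt.
pose k := #|letters c alpha n|.
have k_le : k%:R <= c * a by exact: card_letters_le.
have k_ge : c * a / 4 <= k%:R by exact: card_letters_ge.
have k_gt0 : (0 < k)%N.
  by rewrite -(ltr0n R); apply: lt_le_trans k_ge; rewrite divr_gt0 ?mulr_gt0.
have kL : (k <= L)%N.
  rewrite -(ler_nat R); apply: (le_trans k_le); apply: le_trans (ltW dbL).
  apply: (@le_trans _ _ (d * (a * e))); last by rewrite ler_pM2l.
  by rewrite mulrCA [c * a]mulrC ler_pM2l // mulrC -ler_pdivrMr.
apply: (@le_trans _ _ (uniform_pr R (words c alpha n)
    (fun w => L <= longest_nondecreasing w)%N)).
  rewrite /uniform_pr ler_pM2r ?invr_gt0 ?ltr0n; last first.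
    by rewrite wordsE card_tuple_over expn_gt0 k_gt0.
  rewrite ler_nat; apply/subset_leq_card/fintype.subsetP => w.
  rewrite !inE => /andP[-> /=].
  rewrite subr0 ger0_norm ?divr_ge0 ?ler0n ?powR_ge0 // ltr_pdivlMr //.
  by rewrite truncn_lt_nat // mulr_ge0 ?ltW.
rewrite wordsE; apply: le_trans (uniform_pr_longest_le R n k_gt0 _ _) _ => //.
  by rewrite -card_letters.
have ratio_le : (16 * n)%:R / (L * k)%:R <= bound n.
  rewrite /bound -/e !natrM ler_pdivrMr ?mulr_gt0 ?ltr0n //.
  apply: (@le_trans _ _ (64 / (c * d) * e^-1 * (d * b * (c * a / 4)))).
    have -> : 64 / (c * d) / e * (d * b * (c * a / 4)) = 16 / e * (a * b).
      by field; rewrite !gt_eqF.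
    suff -> : 16 / e * (a * b) = 16 * n%:R by [].
    by rewrite abE; field; rewrite gt_eqF.
  rewrite ler_pM2l ?divr_gt0 //.
  by apply: ler_pM => //; rewrite ?ltW ?mulr_gt0 ?divr_gt0 ?mulr_gt0.
have bound_le1 : bound n <= 1 by rewrite /bound ler_pdivrMr ?mul1r.
apply: (le_trans _ ratio_le); rewrite -[leRHS]expr1.
by apply: ler_wiXn2l; rewrite ?divr_ge0 ?ler0n //; exact: le_trans bound_le1.
Unshelve. all: by end_near.
Qed.
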